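(* For any positive integer $n$, $$\sum_{\pi\in\mathcal S_n}s^{\mathrm{rmin}(\pi)}x^{p_{\rm silly}(\pi)}w^{\mathrm{des}(\pi)}=\sum_{M\in\mathcal N_n}s^{\min(M)}x^{\mathrm{rne}(M)}w^{\mathrm{int}(M)-1}.$$
   Context: **Permutations.** $\mathcal S_n$ is the set of permutations $\pi=\pi(1)\cdots\pi(n)$ of $[n]=\{1,\dots,n\}$. $\mathrm{rmin}(\pi)$ is the number of values $\pi(j)$ with $\pi(j)<\pi(k)$ for all $k>j$. $p_{\rm silly}(\pi)$ is the number of indices $j$ such that $j=1$ or $\pi(j-1)<\pi(j)$, $\pi(j)<n$, and the value $\pi(j)+1$ occurs to the left of $\pi(j)$ in $\pi(1)\cdots\pi(n)$. $\mathrm{des}(\pi)$ is the number of $j\in\{2,\dots,n\}$ with $\pi(j-1)>\pi(j)$. **Matchings.** A matching $M$ of size $n$ is a partition of $[2n]$ into 2-element arcs; an arc $A$ has opener $\mathrm{op}(A)=\min A$ and closer $\mathrm{cl}(A)=\max A$. Arcs are numbered $M_1,\dots,M_n$ by increasing closer. A left nesting is a pair of arcs $A,B$ with $\mathrm{op}(B)<\mathrm{op}(A)<\mathrm{cl}(A)<\mathrm{cl}(B)$ and $\mathrm{op}(A)=\mathrm{op}(B)+1$. $\mathcal N_n$ is the set of matchings of size $n$ with no left nesting. $\mathrm{rne}(M)$ is the number of $i$ with $\mathrm{op}(M_i)<\mathrm{op}(M_{i-1})<\mathrm{cl}(M_{i-1})=\mathrm{cl}(M_i)-1$. $\min(M)=\#\{i:\mathrm{op}(M_i)<\mathrm{cl}(M_1)\}$.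 $\mathrm{int}(M)=n-\#\{i\in\{2,\dots,n\}:\mathrm{cl}(M_{i-1})=\mathrm{cl}(M_i)-1\}$, i.e. the number of maximal runs of consecutive closers in $1,2,\dots,2n$. *)

(* Defs.v *)
From mathcomp Require Import all_boot all_fingroup.

Set Implicit Arguments.
Unset Strict Implicit.
Unset Printing Implicit Defensive.

(* The sets [n] and [2n] are represented by 'I_n and 'I_n.*2, i.e., positions,
   values and points are shifted to start at 0: position 1 becomes j == 0, and
   the value bound pi(j) < n becomes (p j).+1 < n. *)

Section PermutationStatistics.

Variables (n : nat) (p : {perm 'I_n}).

Definition rmin : nat :=
  #|[set j : 'I_n | [forall k : 'I_n, (j < k) ==> (p j < p k)]]|.

Definition ascends_to (j : 'I_n) : bool :=
  [exists k : 'I_n, (k.+1 == j :> nat) && (p k < p j)].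

Definition psilly : nat :=
  #|[set j : 'I_n | [&& (j == 0 :> nat) || ascends_to j,
                        (p j).+1 < n &
                        [exists k : 'I_n,
                           (k < j) && (p k == (p j).+1 :> nat)]]]|.

Definition des : nat :=
  #|[set j : 'I_n |
       [exists k : 'I_n, (k.+1 == j :> nat) && (p j < p k)]]|.

End PermutationStatistics.

Section Matchings.

Variable n : nat.

Notation arc := {set 'I_n.*2}.

Definition is_matching (M : {set arc}) : bool :=
  partition M [set: 'I_n.*2] && [forall A in M, #|A| == 2].

(* On a nonempty A these are min A and max A, as the points are < n.*2. *)
Definition op (A : arc) : nat := \big[minn/n.*2]_(i in A) (i : nat).
Definition cl (A : arc) : nat := \max_(i in A) (i : nat).

Definition left_nesting (A B : arc) : bool :=
  [&& op B < op A, op A < cl A, cl A < cl B & op A == (op B).+1].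

Definition no_left_nesting : {set {set arc}} :=
  [set M : {set arc} | is_matching M &
     ~~ [exists A in M, exists B in M, left_nesting A B]].

(* arc_nth M i is the arc M_(i+1) in the numbering by increasing closer. *)
Definition arc_nth (M : {set arc}) (i : nat) : arc :=
  nth set0 (sort (fun A B => cl A <= cl B) (enum M)) i.

Definition rne (M : {set arc}) : nat :=
  #|[set i : 'I_n | [&& 0 < i,
       op (arc_nth M i) < op (arc_nth M i.-1),
       op (arc_nth M i.-1) < cl (arc_nth M i.-1) &
       (cl (arc_nth M i.-1)).+1 == cl (arc_nth M i)]]|.

Definition mmin (M : {set arc}) : nat :=
  #|[set i : 'I_n | op (arc_nth M i) < cl (arc_nth M 0)]|.

Definition mint (M : {set arc}) : nat :=
  n - #|[set i : 'I_n |
          (0 < i) && ((cl (arc_nth M i.-1)).+1 == cl (arc_nth M i))]|.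

End Matchings.

(* Main.v *)
Require Import Defs.
From mathcomp Require Import all_boot all_fingroup all_algebra.
From mathcomp Require Import zify.

(* Both sides are sums over codes, i.e. sequences c with c_i <= i for i < n.

   A matching without left nestings is determined by c_i = the number of
   closers before the opener of its i-th arc: in a run of openers the arcs
   appear by increasing closer, and any c is possible. Then min counts the
   zeros of c, int its values, and rne the nonzero indices i that are not values
   of c and satisfy c_i < c_(i-1).

   A permutation is encoded by letting c_i be 1 + the first value smaller than i
   to the right of the value i, or 0 if there is none. Then rmin counts the zeros
   of c and des its nonzero values, while psilly counts the nonzero i that are not
   values of c and for which c_i is to the left of c_(i-1) in the permutation (0
   being placed at the far right).

   So the two statistics differ only in the total order in which c_i and c_(i-1)
   are compared. Expanding x^k as a sum of (x-1)^|S| over subsets, one fixes a set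
   S of indices at which the comparison is required. In a block a, ..., a+b-1 of
   indices linked by S the entries form a decreasing sequence in the fixed
   alphabet {0, ..., a} minus S, hence amount to a b-subset of it, whatever the
   order; the remaining weight is symmetric in the entries of c. *)

Set Implicit Arguments.
Unset Strict Implicit.
Unset Printing Implicit Defensive.

Import GRing.Theory.

(** * Codes, as subexceedant sequences *)

Fixpoint codes (n : nat) : seq (seq nat) :=
  if n is m.+1 then [seq rcons c u | c <- codes m, u <- iota 0 m.+1]
  else [:: [::]].

Lemma codesS n : codes n.+1 = [seq rcons c u | c <- codes n, u <- iota 0 n.+1].
Proof. by []. Qed.

Definition subexceedant (c : seq nat) := forall i, i < size c -> nth 0 c i <= i.

Lemma subexceedant_rcons c u :
  subexceedant (rcons c u) <-> subexceedant c /\ u <= size c.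
Proof.
split=> [sub|[sub le_u] i].
  split=> [i lt_i|]; last first.
    by have := sub (size c); rewrite size_rcons nth_rcons ltnn eqxx; apply.
  have := sub i; rewrite size_rcons nth_rcons lt_i; apply; exact: ltnW.
rewrite size_rcons nth_rcons ltnS leq_eqVlt => /predU1P[->|lt_i].
  by rewrite ltnn eqxx.
by rewrite lt_i; apply: sub.
Qed.

Lemma codesP n c : reflect (size c = n /\ subexceedant c) (c \in codes n).
Proof.
apply: (iffP idP); elim: n c => [|n IHn] c; rewrite ?codesS.
- by rewrite inE => /eqP->.
- case/allpairsPdep=> c1 [u [/IHn[size_c sub_c]]]; rewrite mem_iota /= => lt_u ->.
  by rewrite size_rcons size_c; split=> //; apply/subexceedant_rcons; rewrite size_c.
- by case=> /size0nil->.
case/lastP: c => [[]//|c u]; rewrite size_rcons => -[[size_c]].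
case/subexceedant_rcons=> sub_c le_u; apply/allpairsPdep; exists c, u.
by rewrite mem_iota IHn // -size_c.
Qed.

Lemma codes_uniq n : uniq (codes n).
Proof.
elim: n => // n IHn; rewrite codesS; apply: allpairs_uniq => //; first exact: (iota_uniq 0 n.+1).
by move=> [c u] [c' u'] _ _ /= /rcons_inj[-> ->].
Qed.

Lemma size_codes n : size (codes n) = n`!.
Proof. by elim: n => // n IHn; rewrite codesS size_allpairs IHn size_iota factS mulnC. Qed.

Lemma subexceedant_lt c u : subexceedant c -> u \in c -> u < size c.
Proof. by move=> sub /(nthP 0)[i lt_i <-]; apply: leq_ltn_trans (sub _ lt_i) lt_i. Qed.

(** * Words over an alphabet and decreasing words *)

Fixpoint words (A : seq nat) (b : nat) : seq (seq nat) :=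
  if b is b'.+1 then [seq rcons t u | t <- words A b', u <- A] else [:: [::]].

Lemma wordsP A b t : reflect (size t = b /\ {subset t <= A}) (t \in words A b).
Proof.
apply: (iffP idP); elim: b t => [|b IHb] t.
- by rewrite inE => /eqP->.
- case/allpairsPdep=> t1 [u [/IHb[<- sub_t] Au ->]].
  by rewrite size_rcons; split=> // v; rewrite mem_rcons inE => /predU1P[->|/sub_t].
- by case=> /size0nil->.
case/lastP: t => [[]//|t u]; rewrite size_rcons => -[[size_t]] sub_t.
apply/allpairsPdep; exists t, u; split=> //; last first.
  by apply: sub_t; rewrite mem_rcons mem_head.
by apply: IHb; split=> // v t_v; apply: sub_t; rewrite mem_rcons inE t_v orbT.
Qed.

Lemma words_uniq A b : uniq A -> uniq (words A b).
Proof.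
move=> uA; elim: b => //= b IHb; apply: allpairs_uniq => //.
by move=> [c u] [c' u'] _ _ /= /rcons_inj[-> ->].
Qed.

Definition dec (k : nat -> nat) : seq nat -> bool := sorted (fun x y => k y < k x).

Lemma decE k t : dec k t = sorted gtn (map k t).
Proof. by rewrite sorted_map. Qed.

Lemma dec_rcons k t u :
  dec k (rcons t u) = dec k t && ((t == [::]) || (k u < k (last 0 t))).
Proof. by case: t => [|x t] //; rewrite /dec /= rcons_path. Qed.

Lemma dec_sort k t : uniq (map k t) -> dec k (sort (fun x y => k y <= k x) t).
Proof.
move=> ut; rewrite decE gtn_sorted_uniq_geq; apply/andP; split.
  by rewrite (perm_uniq (perm_map _ (permEl (perm_sort _ _)))).
by rewrite sorted_map; apply: sort_sorted => x y; apply: leq_total.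
Qed.

Lemma dec_uniq k t : dec k t -> uniq t.
Proof. by rewrite decE gtn_sorted_uniq_geq => /andP[/map_uniq]. Qed.

Lemma dec_eq k t1 t2 : dec k t1 -> dec k t2 -> perm_eq t1 t2 -> t1 = t2.
Proof.
move=> d1 d2 /perm_mem e; apply: irr_sorted_eq d1 d2 e => [x y z h1 h2|x].
  exact: ltn_trans h2 h1.
exact: ltnn.
Qed.

(** * Symmetric weights summed over codes with marked indices *)

Section Symmetric.

Variables (R : nmodType).
Local Open Scope ring_scope.

Definition symmetric_seq (phi : seq nat -> R) :=
  forall c c', perm_eq c c' -> phi c = phi c'.

(** Each [b]-subset of [A] has one decreasing arrangement for either key, so sorting by [k2] is a
    bijection between the two index sets; it only permutes letters, which [psi] does not see. *)
Lemma sum_dec (A : seq nat) b (k1 k2 : nat -> nat) (psi : seq nat -> R) :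
  uniq A -> {in A &, injective k1} -> {in A &, injective k2} ->
  symmetric_seq psi ->
  \sum_(t <- words A b | dec k1 t) psi t = \sum_(t <- words A b | dec k2 t) psi t.
Proof.
move=> uA inj1 inj2 sym_psi.
pose srt (k : nat -> nat) := sort (fun x y => (k y <= k x)%N).
have srt_perm k t : perm_eq (srt k t) t by apply: permEl; apply: perm_sort.
have mem_srt k k' t : {in A &, injective k} ->
  t \in [seq t <- words A b | dec k' t] -> srt k t \in [seq t <- words A b | dec k t].
  move=> injk; rewrite !mem_filter => /andP[/dec_uniq ut /wordsP[size_t sub_t]].
  rewrite dec_sort /=; last first.
    by rewrite map_inj_in_uniq // => x y /sub_t Ax /sub_t Ay; apply: injk.
  apply/wordsP; rewrite (perm_size (srt_perm k t)); split=> // x.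
  by rewrite (perm_mem (srt_perm k t)); apply: sub_t.
rewrite -big_filter -[RHS]big_filter.
have -> : \sum_(t <- [seq t <- words A b | dec k1 t]) psi t =
          \sum_(t <- [seq srt k2 t | t <- [seq t <- words A b | dec k1 t]]) psi t.
  by rewrite big_map; apply: eq_bigr => t _; apply: sym_psi; rewrite perm_sym.
apply: perm_big; apply: uniq_perm; last first.
- move=> t; apply/mapP/idP => [[t' t'1 ->]|t2]; first exact: mem_srt t'1.
  exists (srt k1 t); first exact: mem_srt t2.
  have := mem_srt _ _ _ inj2 (mem_srt _ _ _ inj1 t2).
  rewrite mem_filter => /andP[d _]; move: t2; rewrite mem_filter => /andP[d' _].
  apply: dec_eq d' d _; rewrite perm_sym.
  exact: perm_trans (srt_perm _ _) (srt_perm _ _).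
- by rewrite filter_uniq ?words_uniq.
rewrite map_inj_in_uniq ?filter_uniq ?words_uniq // => t t'.
rewrite !mem_filter => /andP[d _] /andP[d' _] e; apply: dec_eq d d' _.
by rewrite -(permPl (srt_perm k2 t)) e.
Qed.

(** A key orders the possible entries and may depend on the code. By the second clause an appended
    entry leaves earlier comparisons alone, so validity can be tested one entry at a time. *)
Definition good_key (key : seq nat -> nat -> nat) :=
  (forall c, subexceedant c -> {in [pred x | (x <= size c)%N] &, injective (key c)}) /\
  (forall c u a b, subexceedant (rcons c u) -> (a <= size c)%N -> (b <= size c)%N ->
     (key (rcons c u) a < key (rcons c u) b)%N = (key c a < key c b)%N).

Variable S : pred nat.

Definition valid (key : seq nat -> nat -> nat) (c : seq nat) :=
  all (fun i => S i ==> [&& 0 < i, i \notin c & key c (nth 0 c i) < key c (nth 0 c i.-1)])%N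
      (iota 0 (size c)).

(** Entries of [c] are below [size c], so the new index does not occur in [c], and appending [u] can
    spoil an earlier marked index only by being equal to it. The factor [~~ S u] also covers
    [u = size c]. *)
Lemma valid_rcons key c u : good_key key -> subexceedant (rcons c u) ->
  valid key (rcons c u) = [&& valid key c, ~~ S u &
     S (size c) ==> ((0 < size c) && (key c u < key c (last 0 c)))%N].
Proof.
move=> [_ gk] sub_cu; have [sub_c le_u] := (subexceedant_rcons c u).1 sub_cu.
rewrite /valid size_rcons -[(size c).+1]addn1 iotaD all_cat /= add0n andbT.
rewrite nth_rcons ltnn eqxx.
have -> : all (fun i => S i ==> [&& 0 < i, i \notin rcons c u &
     key (rcons c u) (nth 0 (rcons c u) i) < key (rcons c u) (nth 0 (rcons c u) i.-1)])%N
      (iota 0 (size c)) = valid key c && all (fun i => S i ==> (i != u)) (iota 0 (size c)).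
  rewrite -all_predI; apply: eq_in_all => i; rewrite mem_iota /= add0n => lt_i.
  rewrite !nth_rcons lt_i (leq_ltn_trans (leq_pred i) lt_i) mem_rcons inE negb_or.
  have lt_i1 := leq_ltn_trans (leq_pred i) lt_i.
  rewrite gk //; last 2 first.
  - exact: leq_trans (sub_c _ lt_i) (ltnW lt_i).
  - exact: leq_trans (sub_c _ lt_i1) (ltnW lt_i1).
  by case: (S i); case: (i != u); rewrite ?andbT ?andbF //= ?andbF.
rewrite -andbA; congr (_ && _).
rewrite mem_rcons inE negb_or.
have [c0|c_gt0] := posnP (size c).
  have c_nil := size0nil c0; rewrite {}c_nil {c0 gk sub_c} /= in sub_cu le_u *.
  move: le_u; rewrite leqn0 => /eqP->; by case: (S 0%N).
rewrite nth_rcons ltn_predL c_gt0 nth_last gk //; last first.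
  by rewrite -nth_last (leq_trans (sub_c _ _)) ?ltn_predL // leq_pred.
have -> : size c \notin c.
  by apply/negP => /(subexceedant_lt sub_c); rewrite ltnn.
rewrite andbT /=.
have [ltu|eq_u] := boolP (u < size c)%N.
  rewrite gtn_eqF //=; congr (_ && _).
  apply/allP/idP => [/(_ u)|nSu i _].
    by rewrite mem_iota eqxx implybF; apply.
  by apply/implyP => Si; apply: contra nSu => /eqP<-.
have -> : u = size c by apply/eqP; rewrite eqn_leq le_u leqNgt.
rewrite eqxx /= implybF.
have -> : all (fun i => S i ==> (i != size c)) (iota 0 (size c)).
  apply/allP => i; rewrite mem_iota /= add0n => lt_i; rewrite ltn_eqF //.
  by rewrite implybT.
by case: (S _).
Qed.


Lemma sum_codesS (P : pred (seq nat)) (phi : seq nat -> R) n :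
  \sum_(c <- codes n.+1 | P c) phi c =
  \sum_(c <- codes n) \sum_(u <- iota 0 n.+1 | P (rcons c u)) phi (rcons c u).
Proof.
rewrite big_mkcond codesS big_allpairs_dep; apply: eq_bigr => c _.
by rewrite [RHS]big_mkcond.
Qed.

Lemma sum_wordsS (P : pred (seq nat)) (phi : seq nat -> R) A b :
  \sum_(t <- words A b.+1 | P t) phi t =
  \sum_(t <- words A b) \sum_(u <- A | P (rcons t u)) phi (rcons t u).
Proof.
rewrite big_mkcond big_allpairs_dep; apply: eq_bigr => c _.
by rewrite [RHS]big_mkcond.
Qed.

Lemma good_key_cat key c t a b : good_key key -> subexceedant (c ++ t) ->
  (a <= size c)%N -> (b <= size c)%N ->
  (key (c ++ t) a < key (c ++ t) b)%N = (key c a < key c b)%N.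
Proof.
case=> _ gk; elim/last_ind: t => [|t u IHt] sub_ct le_a le_b; first by rewrite cats0.
move: sub_ct; rewrite -rcons_cat => sub_ct.
have [sub_ct' _] := (subexceedant_rcons _ _).1 sub_ct.
by rewrite gk ?IHt // size_cat; apply: leq_trans (leq_addr _ _).
Qed.

(* The indices [a, a + b) form a block linked by S, so their entries avoid S and
   hence are at most a: the alphabet does not depend on the rest of the code. *)
Lemma sum_valid_block key a b (phi : seq nat -> R) :
  good_key key -> ~~ S a -> (forall i, (a < i < a + b)%N -> S i) ->
  \sum_(c <- codes (a + b) | valid key c) phi c =
  \sum_(c <- codes a | valid key c)
     \sum_(t <- words [seq u <- iota 0 a.+1 | ~~ S u] b | dec (key c) t) phi (c ++ t).
Proof.
move=> gk nSa; set A := filter _ _.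
elim: b phi => [|b IHb] phi Sab.
  rewrite addn0; apply: eq_bigr => c _.
  by rewrite /= big_cons big_nil /= cats0 addr0.
have valid_step c u : c \in codes (a + b) -> (u <= a + b)%N ->
  valid key (rcons c u) = [&& valid key c, ~~ S u &
     S (a + b) ==> ((0 < a + b) && (key c u < key c (last 0 c)))%N].
  move=> /codesP[size_c sub_c] le_u; rewrite valid_rcons ?size_c //.
  by apply/subexceedant_rcons; rewrite size_c.
pose ok c u := (~~ S u &&
     (S (a + b) ==> ((0 < a + b) && (key c u < key c (last 0 c)))))%N.
pose psi c := \sum_(u <- iota 0 (a + b).+1 | ok c u) phi (rcons c u).
transitivity (\sum_(c <- codes (a + b) | valid key c) psi c).
  rewrite addnS sum_codesS [RHS]big_mkcond; apply: eq_big_seq => c c_code.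
  rewrite /psi; case: ifP => vc; rewrite big_seq_cond.
    rewrite [RHS]big_seq_cond; apply: eq_bigl => u; rewrite mem_iota /= add0n ltnS.
    by case: leqP => //= le_u; rewrite valid_step // vc.
  rewrite big_pred0 // => u; rewrite mem_iota /= add0n ltnS.
  by case: leqP => //= le_u; rewrite valid_step // vc.
rewrite IHb; last by move=> i /andP[lt_a lt_i]; apply: Sab; rewrite lt_a addnS ltnW.
rewrite big_seq_cond [RHS]big_seq_cond; apply: eq_bigr => c /andP[/codesP[size_c sub_c] _].
rewrite sum_wordsS big_mkcond; apply: eq_big_seq => t /wordsP[size_t sub_t].
under [RHS]eq_bigl do rewrite dec_rcons.
case: ifP => [dt|_]; last by rewrite big_pred0.
rewrite big_filter_cond /psi -addSn iotaD; set r := iota 0 a.+1.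
rewrite big_cat /= add0n.
(* Entries from [a.+1] to [a + b] are marked indices, hence forbidden. *)
rewrite [\sum_(u <- iota a.+1 b | _) _]big_seq_cond.
rewrite [\sum_(u <- iota a.+1 b | _) _]big_pred0 => [|u]; last first.
  rewrite mem_iota /ok addSn ltnS; apply/negP => /andP[lt_u /andP[/negP[]]].
  by apply: Sab; rewrite addnS ltnS.
rewrite addr0 big_seq_cond [RHS]big_seq_cond; apply: eq_big => [u|u _]; last first.
  by rewrite rcons_cat.
rewrite /r mem_iota /= add0n ltnS; case: (leqP u a) => //= le_u; rewrite /ok.
case: (boolP (S u)) => //= nSu.
(* For empty [t] the new index is [a] itself, which is unmarked, so no comparison is required. *)
have [t0|t_nil] := eqVneq t [::].
  have b0 : b = 0%N by rewrite -size_t t0.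
  by rewrite b0 addn0 (negPf nSa).
have b_gt0 : (0 < b)%N by rewrite -size_t lt0n size_eq0.
have sub_ct : subexceedant (c ++ t).
  move=> i; rewrite size_cat nth_cat size_c size_t => lt_i.
  case: ltnP => [lt_ia|le_ai]; first by apply: sub_c; rewrite size_c.
  have : nth 0 t (i - a) \in A by rewrite sub_t // mem_nth // size_t ltn_subLR.
  rewrite mem_filter mem_iota /= add0n ltnS => /andP[_ le_nth].
  exact: leq_trans le_nth le_ai.
rewrite Sab ?addnS ?leqnn ?addn_gt0 ?b_gt0 ?orbT /=; last by rewrite -addn1 leq_add2l b_gt0.
have last_ct : last 0 (c ++ t) = last 0 t by case: (t) t_nil => // x t'; rewrite last_cat.
rewrite last_ct good_key_cat ?size_c //.
have : last 0 t \in A by apply: sub_t; case: (t) t_nil => // x t' _; apply: mem_last.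
by rewrite mem_filter mem_iota /= add0n ltnS => /andP[].
Qed.

(** Strong induction on the length, splitting off the last block of linked indices. *)
Theorem sum_valid key1 key2 n (phi : seq nat -> R) :
  good_key key1 -> good_key key2 -> ~~ S 0 -> symmetric_seq phi ->
  \sum_(c <- codes n | valid key1 c) phi c = \sum_(c <- codes n | valid key2 c) phi c.
Proof.
move=> gk1 gk2 nS0; elim/ltn_ind: n phi => -[|n] IHn phi sym_phi.
  by rewrite !big_cons !big_nil.
(* [a] is the last unmarked index, where the final block starts; it exists because 0 is unmarked. *)
have [||a] := @ex_maxnP (fun i => (i <= n)%N && ~~ S i) n.
- by exists 0%N.
- by move=> i /andP[].
move=> /andP[le_a nSa] max_a.
have Sb i : (a < i < a + (n.+1 - a))%N -> S i.
  rewrite subnKC; last exact: leqW.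
  case/andP=> lt_a lt_i; apply: contraTT lt_a => nSi.
  by rewrite -leqNgt max_a // -ltnS lt_i.
(* Once the block is rearranged by [id], its sum no longer involves the key and is again symmetric
   in [c], so the induction hypothesis applies to it. *)
pose Phi c := \sum_(t <- words [seq u <- iota 0 a.+1 | ~~ S u] (n.+1 - a) | dec id t)
  phi (c ++ t).
have sum_Phi key : good_key key ->
    \sum_(c <- codes n.+1 | valid key c) phi c = \sum_(c <- codes a | valid key c) Phi c.
  move=> gk; rewrite -[X in codes X](subnKC (leqW le_a)) sum_valid_block //.
  rewrite big_seq_cond [RHS]big_seq_cond.
  apply: eq_bigr => c /andP[/codesP[size_c sub_c] _].
  apply: sum_dec => [|u v|//|t t' tt']; first by rewrite filter_uniq // iota_uniq.
    rewrite !mem_filter !mem_iota !add0n !ltnS => /andP[_ u_a] /andP[_ v_a].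
    by apply: gk.1; rewrite // inE size_c.
  by apply: sym_phi; rewrite perm_cat2l.
rewrite !sum_Phi //; apply: IHn => // c c' cc'.
by apply: eq_bigr => t _; apply: sym_phi; rewrite perm_cat2r.
Qed.


End Symmetric.

(** * Independence of the descent distribution from the key *)

Section Equidistribution.

(** With the key [pos] this set gives [psilly], with the identity key it gives [rne]. *)
Definition descents n (key : seq nat -> nat -> nat) (c : seq nat) : {set 'I_n} :=
  [set i : 'I_n | [&& 0 < i, (i : nat) \notin c &
                      key c (nth 0 c i) < key c (nth 0 c i.-1)]].

Variable R : comNzRingType.
Local Open Scope ring_scope.

(** Expand a product with one factor [(x - 1) + 1] for each element of [A] and [0 + 1] for every
    other index. *)
Lemma expr_card_sum_subset (I : finType) (A : {set I}) (x : R) :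
  x ^+ #|A| = \sum_(S : {set I} | S \subset A) (x - 1) ^+ #|S|.
Proof.
have -> : x ^+ #|A| = \prod_i ((if i \in A then x - 1 else 0) + 1).
  rewrite -prodr_const big_mkcond; apply: eq_bigr => i _.
  by case: ifP; rewrite ?subrK ?add0r.
rewrite bigA_distr [RHS]big_mkcond; apply: eq_bigr => S _.
rewrite -big_mkcond /=; case: ifPn => [sSA|/subsetPn[i Si nAi]].
  rewrite (eq_bigr (fun=> x - 1)) ?prodr_const // => i /(subsetP sSA) ->//.
by rewrite (bigD1 i) //= (negPf nAi) mul0r.
Qed.

Lemma sum_codes_descents key1 key2 n (phi : seq nat -> R) (x : R) :
  good_key key1 -> good_key key2 -> symmetric_seq phi ->
  \sum_(c <- codes n) phi c * x ^+ #|descents n key1 c| =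
  \sum_(c <- codes n) phi c * x ^+ #|descents n key2 c|.
Proof.
move=> gk1 gk2 sym_phi.
pose marked (S : {set 'I_n}) (k : nat) := [exists i in S, i == k :> nat].
have sum_key key : good_key key ->
    \sum_(c <- codes n) phi c * x ^+ #|descents n key c| =
    \sum_(S : {set 'I_n}) (x - 1) ^+ #|S| *
       \sum_(c <- codes n | valid (marked S) key c) phi c.
  move=> gk; under eq_bigr do rewrite expr_card_sum_subset big_mkcond mulr_sumr /=.
  rewrite exchange_big /=; apply: eq_bigr => S _.
  rewrite mulr_sumr [RHS]big_mkcond big_seq [RHS]big_seq; apply: eq_bigr => c /codesP[size_c _].
  have -> : valid (marked S) key c = (S \subset descents n key c).
    rewrite /valid size_c; apply/allP/subsetP => [v i Si|sS k].
      have := v i; rewrite mem_iota /= ltn_ord => /(_ isT).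
      have -> : marked S i by apply/existsP; exists i; rewrite Si /=.
      by rewrite inE.
    rewrite mem_iota => _; apply/implyP => /existsP[i /andP[/sS + /eqP<-]].
    by rewrite inE.
  by case: ifP; rewrite ?mulr0 // mulrC.
rewrite !sum_key //; apply: eq_bigr => S _; congr (_ * _).
case: n @marked S {sum_key} => [|n] marked S; first by rewrite !big_cons !big_nil.
have [S0|nS0] := boolP (marked S 0%N); last exact: sum_valid.
(* Index 0 is never a descent, so marking it leaves no valid code for any key. *)
have invalid key : \sum_(c <- codes n.+1 | valid (marked S) key c) phi c = 0.
  rewrite big_seq_cond big_pred0 // => c; apply/negP => /andP[/codesP[size_c _]].
  by rewrite /valid size_c /= S0.
by rewrite !invalid.
Qed.

End Equidistribution.

(** * The order of vertices built by successive insertion *)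

Section Position.

(* [posn c k] numbers from left to right the vertices 0, ..., k, where vertex
   [i.+1] was inserted immediately before its parent [nth 0 c i]. *)
Fixpoint posn (c : seq nat) (k a : nat) : nat :=
  if k is k'.+1 then
    let h := posn c k' (nth 0 c k') in
    if a == k then h else bump h (posn c k' a)
  else 0.

Definition pos (c : seq nat) : nat -> nat := posn c (size c).

Lemma ltn_bump2 h i j : (bump h i < bump h j) = (i < j).
Proof. by rewrite !ltnNge leq_bump2. Qed.

Lemma ltn_bumpr h j : (h < bump h j) = (h <= j).
Proof. by rewrite /bump; case: leqP => hj; lia. Qed.

Lemma ltn_bumpl h i : (bump h i < h) = (i < h).
Proof. by rewrite /bump; case: leqP => hi; lia. Qed.

Lemma posn_inj c k : (forall i, i < k -> nth 0 c i <= i) ->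
  {in [pred x | x <= k] &, injective (posn c k)}.
Proof.
elim: k => [|k IHk] sub a b; rewrite !inE.
  by rewrite !leqn0 => /eqP-> /eqP->.
have {}IHk := IHk (fun i lt_i => sub i (ltnW lt_i)).
rewrite /= (leq_eqVlt a) (leq_eqVlt b) !ltnS.
case: eqVneq => [->|ak]; case: eqVneq => [->|bk] //= le_a le_b.
- by move/eqP; rewrite (negPf (neq_bump _ _)).
- by move/eqP; rewrite eq_sym (negPf (neq_bump _ _)).
- by move/(can_inj (bumpK _))/IHk; apply.
Qed.

Lemma posn_rcons c u k : k <= size c -> posn (rcons c u) k =1 posn c k.
Proof.
elim: k => [|k IHk] //= lt_k a.
by rewrite nth_rcons lt_k !IHk // ltnW.
Qed.

(** An insertion moves the old vertices by [bump], which is strictly increasing, so their order is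
    kept. *)
Lemma good_key_pos : good_key pos.
Proof.
split=> [c sub_c|c u a b _ le_a le_b]; first exact: posn_inj.
rewrite /pos size_rcons /= nth_rcons ltnn eqxx.
by rewrite !ltn_eqF ?ltnS // ltn_bump2 !posn_rcons.
Qed.

Lemma good_key_id : good_key (fun _ => id).
Proof. by split=> // c _ u v _ _. Qed.

End Position.

(** * Ranks in a finite type *)

Lemma card_lt_val n m : m <= n -> #|[set j : 'I_n | j < m]| = m.
Proof.
move=> le_m; rewrite -sum1_card; under eq_bigl do rewrite inE.
by have /= <- := big_ord_widen n (fun=> 1) le_m; rewrite sum1_card card_ord.
Qed.

Section Rank.

Variables (T : finType) (f : T -> nat).

Definition rank (t : T) : nat := #|[set u | f u < f t]|.

Lemma rank_lt t : rank t < #|T|.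
Proof.
rewrite -cardsT; apply: proper_card; rewrite properE subsetT /=.
by apply/subsetPn; exists t; rewrite !inE ?ltnn.
Qed.

Lemma ltn_rank t u : (rank t < rank u) = (f t < f u).
Proof.
have le_rank a b : f a <= f b -> rank a <= rank b.
  move=> le_ab; apply: subset_leq_card; apply/subsetP => v; rewrite !inE => lt_v.
  exact: leq_trans lt_v le_ab.
case: (ltnP (f t) (f u)) => [lt_tu|/le_rank]; last by rewrite ltnNge => ->.
apply: proper_card; rewrite properE; apply/andP; split.
  by apply/subsetP => v; rewrite !inE => /ltn_trans; apply.
by apply/subsetPn; exists t; rewrite !inE ?ltnn.
Qed.

Hypothesis f_inj : injective f.

Lemma rank_inj : injective rank.
Proof.
move=> t u e; apply: f_inj; case: (ltngtP (f t) (f u)) => //; rewrite -ltn_rank e ltnn //.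
Qed.

Lemma rank_id : (forall t, f t < #|T|) -> rank =1 f.
Proof.
move=> lt_f t; rewrite -[RHS](card_lt_val (ltnW (lt_f t))).
pose g u := Ordinal (lt_f u).
have g_inj : injective g by move=> u v /(congr1 val)/f_inj.
have [h _ gK] := inj_card_bij g_inj (eq_leq (card_ord _)).
rewrite /rank -(card_imset _ g_inj); apply: eq_card => j; rewrite inE.
apply/imsetP/idP => [[u + ->]|lt_j]; first by rewrite inE.
by exists (h j); rewrite ?inE ?gK //; move: lt_j; rewrite -{1}(gK j).
Qed.

End Rank.

(** * The code of a permutation *)

Section PermutationCode.

Variable n : nat.
Implicit Types (p q : {perm 'I_n}) (i j k : 'I_n).

(** The shift by one frees 0 for a sentinel: it matches no value, and the default [n] puts it to the
    right of every position. *)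
Definition place p (v : nat) : nat :=
  if [pick j | (p j).+1 == v :> nat] is Some j then j else n.

Lemma place_perm p j : place p (p j).+1 = j.
Proof.
rewrite /place; case: pickP => [k /eqP[/val_inj/perm_inj->]//|/(_ j)].
by rewrite eqxx.
Qed.

Lemma place0 p : place p 0 = n.
Proof. by rewrite /place; case: pickP. Qed.

Lemma perm_value p v : 0 < v <= n -> exists j, v = (p j).+1.
Proof.
case: v => // v lt_v; exists ((p^-1)%g (Ordinal lt_v)); by rewrite permKV.
Qed.

Lemma place_lt p v : 0 < v <= n -> place p v < n.
Proof. by case/(perm_value p)=> j ->; rewrite place_perm. Qed.

Lemma place_inj p : {in [pred v | v <= n] &, injective (place p)}.
Proof.
move=> u v; rewrite !inE.
case: u v => [|u] [|v] // le_u le_v; rewrite ?place0 => e.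
- by have := @place_lt p v.+1 le_v; rewrite -e ltnn.
- by have := @place_lt p u.+1 le_u; rewrite e ltnn.
have [j ej] := @perm_value p u.+1 le_u; have [k ek] := @perm_value p v.+1 le_v.
by move: e; rewrite ej ek !place_perm => /val_inj->.
Qed.

(* Vertex [v.+1] stands for the value [v] and vertex 0 for a sentinel at the right
   end; the parent of vertex [m.+1] is the first smaller vertex to its right. *)
Definition parent p (m : nat) : nat :=
  [arg min_(u < (ord0 : 'I_m.+1) | place p m.+1 < place p u) place p u].

Lemma parentP p m : m < n ->
  [/\ parent p m <= m, place p m.+1 < place p (parent p m) &
      forall u, u <= m -> place p m.+1 < place p u -> place p (parent p m) <= place p u].
Proof.
move=> lt_m; rewrite /parent; case: arg_minnP => [|u lt_u min_u].
  by rewrite place0; apply: place_lt.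
split=> [||v le_v lt_v] //; first by rewrite -ltnS.
by have := min_u (Ordinal (le_v : v < m.+1)); apply.
Qed.

Definition perm_code p : seq nat := mkseq (parent p) n.

Lemma nth_perm_code p m : m < n -> nth 0 (perm_code p) m = parent p m.
Proof. by move=> lt_m; rewrite nth_mkseq. Qed.

Lemma mem_perm_code p u :
  reflect (exists2 m, m < n & parent p m = u) (u \in perm_code p).
Proof.
apply: (iffP mapP) => [[m]|[m lt_m <-]]; last by exists m; rewrite // mem_iota.
by rewrite mem_iota => lt_m ->; exists m.
Qed.

Lemma perm_code_codes p : perm_code p \in codes n.
Proof.
apply/codesP; rewrite size_mkseq; split=> // m; rewrite size_mkseq => lt_m.
by rewrite nth_perm_code //; have [] := parentP p lt_m.
Qed.

(** Among the vertices [0, ..., m] the parent of [m.+1] is the nearest one to its right, so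
    inserting [m.+1] immediately before it reproduces the order in the permutation. *)
Lemma ltn_posn_place p m a b : m <= n -> a <= m -> b <= m ->
  (posn (perm_code p) m a < posn (perm_code p) m b) = (place p a < place p b).
Proof.
elim: m a b => [|m IHm] a b lt_m.
  by rewrite !leqn0 => /eqP-> /eqP->; rewrite !ltnn.
have {}IHm := fun a b => IHm a b (ltnW lt_m).
have [le_par lt_par min_par] := parentP p lt_m.
rewrite /= nth_perm_code // (leq_eqVlt a) (leq_eqVlt b) !ltnS.
case: (eqVneq a m.+1) => [->|_]; case: (eqVneq b m.+1) => [->|_] //= le_a le_b.
- by rewrite !ltnn.
- rewrite ltn_bumpr leqNgt IHm // -leqNgt; apply/idP/idP; last exact: min_par.
  exact: leq_trans.
- rewrite ltn_bumpl IHm //; apply/idP/idP => [lt_a|]; last by move/ltn_trans; apply.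
  rewrite ltnNge leq_eqVlt negb_or; apply/andP; split.
    apply/eqP => /(@place_inj p); rewrite !inE lt_m => /(_ isT (leq_trans le_a (ltnW lt_m))).
    by move=> eq_a; rewrite -eq_a ltnn in le_a.
  by apply: contraL lt_a => /(min_par _ le_a); rewrite -leqNgt.
- by rewrite ltn_bump2 IHm.
Qed.

(** The code fixes the relative order of the values, and the position of a value is its rank in that
    order; this recovers the inverse permutation. *)
Lemma perm_code_inj : injective perm_code.
Proof.
move=> p q e; apply: invg_inj; apply/permP => i; apply: val_inj.
have lt_pq a b : a <= n -> b <= n -> (place p a < place p b) = (place q a < place q b).
  by move=> le_a le_b; rewrite -!(@ltn_posn_place _ n) // e.
have placeV (r : {perm 'I_n}) k : place r k.+1 = (r^-1)%g k.
  by rewrite -{1}[k](permKV r) place_perm.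
have rankV (r : {perm 'I_n}) : rank (fun k : 'I_n => place r k.+1) i = (r^-1)%g i.
  rewrite rank_id ?placeV // => [j k|k]; last by rewrite card_ord placeV.
  by rewrite !placeV => /val_inj/perm_inj.
by rewrite /= -!rankV; apply: eq_card => k; rewrite !inE lt_pq.
Qed.

Lemma perm_codes : perm_eq [seq perm_code p | p : {perm 'I_n}] (codes n).
Proof.
have u : uniq [seq perm_code p | p : {perm 'I_n}].
  by rewrite map_inj_uniq ?enum_uniq //; apply: perm_code_inj.
have sub : {subset [seq perm_code p | p : {perm 'I_n}] <= codes n}.
  by move=> c /mapP[p _ ->]; apply: perm_code_codes.
have le_size : size (codes n) <= size [seq perm_code p | p : {perm 'I_n}].
  by rewrite size_codes size_map -cardE card_Sn.
have [_ e] := uniq_min_size u sub le_size.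
exact: uniq_perm (codes_uniq n) e.
Qed.

End PermutationCode.

(** * Permutation statistics read off the code *)

Section PermutationStatistics.

Variable n : nat.
Implicit Types (p : {perm 'I_n}) (i j k : 'I_n).

(** This passes from a value [v] to its vertex [v.+1]; nothing is lost at the upper end because [P]
    fails at [n]. *)
Lemma card_shift (P : pred nat) : (forall m, P m -> m < n) ->
  #|[set i : 'I_n | P i.+1]| = #|[set i : 'I_n | 0 < i & P i]|.
Proof.
move=> ltP; rewrite -!sum1_card; under eq_bigl do rewrite inE.
under [RHS]eq_bigl do rewrite inE.
rewrite big_mkcond [RHS]big_mkcond /=.
case: (n) ltP => [|m] ltP; first by rewrite !big_ord0.
rewrite big_ord_recr big_ord_recl /= addnC; congr (_ + _).
by case: ifP => // /ltP; rewrite ltnn.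
Qed.

Lemma card_perm_preim p (P Q : pred 'I_n) : (forall j, Q j = P (p j)) ->
  #|[set j | Q j]| = #|[set i | P i]|.
Proof.
move=> QP; rewrite -(card_imset _ (@perm_inj _ p)); apply: eq_card => i.
rewrite !inE; apply/imsetP/idP => [[j + ->]|Pi]; first by rewrite inE QP.
by exists ((p^-1)%g i); rewrite ?inE ?QP permKV.
Qed.

Lemma count_code (c : seq nat) (a : pred nat) : size c = n ->
  count a c = #|[set i : 'I_n | a (nth 0 c i)]|.
Proof.
move=> size_c; rewrite -sum1_count (big_nth 0) big_mkord size_c -sum1_card.
by apply: eq_bigl => i; rewrite inE.
Qed.

Lemma rmin_perm_code p : rmin p = count_mem 0 (perm_code p).
Proof.
rewrite (count_code (c := perm_code p)) ?size_mkseq //.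
under [in RHS]eq_finset => i do rewrite nth_perm_code //.
apply: (@card_perm_preim p) => j /=.
have [le_par lt_par min_par] := parentP p (ltn_ord (p j)).
rewrite place_perm in lt_par min_par.
apply/forallP/eqP => [rm|par0 k]; last first.
  apply/implyP => lt_jk; rewrite ltnNge leq_eqVlt negb_or; apply/andP; split.
    by apply: contraTneq lt_jk => /val_inj/perm_inj->; rewrite ltnn.
  apply/negP => lt_k; have := min_par _ lt_k.
  by rewrite par0 place0 place_perm => /(_ lt_jk); rewrite leqNgt ltn_ord.
case: (posnP (parent p (p j))) => // par_gt0.
have [|k ek] := @perm_value _ p (parent p (p j)).
  by rewrite par_gt0 (leq_trans le_par) // ltnW.
rewrite ek place_perm in lt_par le_par.
by have := implyP (rm k) lt_par; rewrite ltnNge ltnW.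
Qed.

(** An entry preceded by a larger one is the parent of that one. Conversely, if the entry at [j] is
    the parent of an earlier one, the entry just before [j] is that child or lies after it; in both
    cases it is not smaller than the child, hence larger than the entry at [j]. *)
Lemma descent_perm_code p j :
  [exists k : 'I_n, (k.+1 == j :> nat) && (p j < p k)] = ((p j).+1 \in perm_code p).
Proof.
apply/existsP/mem_perm_code => [[k /andP[/eqP jk lt_p]]|[m lt_m par_m]].
  have [le_par lt_par min_par] := parentP p (ltn_ord (p k)).
  rewrite place_perm in lt_par min_par; exists (p k) => //.
  apply: (@place_inj _ p); rewrite ?inE //; first by rewrite (leq_trans le_par) // ltnW.
  apply/eqP; rewrite place_perm eqn_leq -{2}jk lt_par andbT.
  by have := min_par _ lt_p; rewrite place_perm -jk ltnSn; apply.
have [le_par lt_par min_par] := parentP p lt_m.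
have [l el] := @perm_value _ p m.+1 lt_m.
rewrite el par_m !place_perm in lt_par min_par; rewrite par_m in le_par.
case: el => el; rewrite {}el {m lt_m} in le_par min_par par_m.
have lt_k : j.-1 < n by rewrite (leq_ltn_trans (leq_pred j)).
exists (Ordinal lt_k); have j1 : j.-1.+1 = j by rewrite prednK // (leq_ltn_trans _ lt_par).
rewrite /= j1 eqxx /= ltnNge leq_eqVlt negb_or; apply/andP; split.
  by apply/eqP => /val_inj/perm_inj/(congr1 val) /= e; lia.
apply/negP => lt_pk.
have := min_par _ (leq_trans lt_pk (ltnW le_par)).
have lt_lk : l < j.-1.
  rewrite ltn_neqAle -ltnS j1 lt_par andbT; apply/eqP => e; move: lt_pk.
  rewrite (_ : Ordinal lt_k = l); last exact: val_inj.
  by rewrite ltnNge ltnW.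
by rewrite place_perm /= => /(_ lt_lk); lia.
Qed.

(** If vertex [m.+2] precedes [m.+1], its parent is no further right than [m.+1], which precedes its
    own parent. Otherwise the parent of [m.+2], not being [m.+1], is at most [m] and to the right of
    [m.+1], so the parent of [m.+1] is no further right than it. *)
Lemma leaf_order p m : m.+1 < n -> m.+1 \notin perm_code p ->
  (place p m.+2 < place p m.+1) = (place p (parent p m.+1) < place p (parent p m)).
Proof.
move=> lt_m leaf.
have [le_a lt_a min_a] := parentP p lt_m.
have [le_b lt_b min_b] := parentP p (ltnW lt_m).
have ltam : parent p m.+1 < m.+1.
  rewrite ltn_neqAle le_a andbT; apply: contra leaf => /eqP e.
  by apply/mem_perm_code; exists m.+1.
apply/idP/idP => [lt_place|].
  exact: leq_ltn_trans (min_a _ (leqnn _) lt_place) lt_b.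
by rewrite !ltnNge; apply: contra => le_place; apply: min_b (leq_ltn_trans le_place lt_a).
Qed.

Lemma psilly_perm_code p : psilly p = #|descents n pos (perm_code p)|.
Proof.
(* For [m > 0] this speaks of the value [m - 1]: it is not the largest, it does not follow a larger
   entry, and the next value is to its left. *)
pose P m := [&& m < n, m \notin perm_code p &
                place p m.+1 < place p m].
transitivity #|[set i : 'I_n | P i.+1]|.
  apply: (@card_perm_preim p) => j; rewrite /P -descent_perm_code andbCA /=.
  case: (ltnP (p j).+1 n) => [lt_pj|] //=; have -> : (j == 0 :> nat) || ascends_to p j =
      ~~ [exists k : 'I_n, (k.+1 == j :> nat) && (p j < p k)].
    apply/orP/existsPn => [[/eqP->|/existsP[l /andP[/eqP lj lt_p]]] k //|ndesc].
      apply/negP => /andP[/eqP kj]; rewrite (_ : k = l); last by (apply: val_inj => /=; lia).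
      by rewrite ltnNge ltnW.
    case: (posnP j) => [_|j_gt0]; [by left|right].
    have lt_k : j.-1 < n by rewrite (leq_ltn_trans (leq_pred j)).
    apply/existsP; exists (Ordinal lt_k); have /= := ndesc (Ordinal lt_k).
    rewrite prednK // eqxx /= -leqNgt leq_eqVlt => /predU1P[|//].
    move/val_inj/perm_inj/(congr1 val) => /= e.
    by exfalso; clear -e j_gt0; lia.
  pose k := (p^-1)%g (Ordinal lt_pj).
  have pk : (p j).+1 = p k by rewrite permKV.
  rewrite pk place_perm -pk place_perm; congr (_ && _).
  apply/existsP/idP => [[l /andP[lt_l /eqP pl]]|lt_k]; last first.
    by exists k; rewrite lt_k pk eqxx.
  by rewrite (_ : k = l) //; apply: (@perm_inj _ p); apply: val_inj; rewrite /= -pk.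
rewrite [LHS](@card_shift P) => [|m /andP[]//]; apply: eq_card => i; rewrite !inE /P ltn_ord /=.
case: (posnP i) => //= i_gt0; case: (boolP (_ \notin _)) => //= leaf.
have size_c : size (perm_code p) = n by rewrite size_mkseq.
have lt_i : i.-1 < n by rewrite (leq_ltn_trans (leq_pred i)).
rewrite /pos size_c !nth_perm_code // ltn_posn_place //; last 2 first.
- have [le_par _ _] := parentP p (ltn_ord i).
  by rewrite (leq_trans le_par) // ltnW.
- have [le_par _ _] := parentP p lt_i.
  by rewrite (leq_trans le_par) // ltnW.
by rewrite -{1 2 3}(prednK i_gt0) leaf_order ?prednK.
Qed.

Lemma des_perm_code p : des p = #|[set i : 'I_n | 0 < i & (i : nat) \in perm_code p]|.
Proof.
rewrite -(@card_shift (fun m => m \in perm_code p)) => [|m]; last first.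
  have /codesP[size_c sub_c] := perm_code_codes p.
  by move/(subexceedant_lt sub_c); rewrite size_c.
by apply: (@card_perm_preim p) => j; rewrite descent_perm_code.
Qed.

End PermutationStatistics.

(** * The code of a matching *)

Section MatchingCode.

Variable n : nat.
Local Notation arc := {set 'I_n.*2}.
Implicit Types (M : {set arc}) (A B : arc) (i j k : 'I_n).

Lemma op_set2 (x y : 'I_n.*2) : x < y -> op [set x; y] = x.
Proof.
move=> lt_xy; apply/eqP; rewrite eqn_leq; apply/andP; split.
  rewrite /op; elim: (index_enum _) (mem_index_enum x) => //= z r IHr.
  rewrite inE big_cons => /predU1P[<-|/IHr le_x]; first by rewrite set21 geq_min leqnn.
  by case: ifP => _; rewrite ?geq_min le_x ?orbT.
rewrite /op; apply: (big_ind (fun m => x <= m)) => [|a b xa xb|z].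
- exact: ltnW.
- by rewrite leq_min xa.
- by case/set2P=> ->; rewrite // ltnW.
Qed.

Lemma cl_set2 (x y : 'I_n.*2) : x < y -> cl [set x; y] = y.
Proof.
move=> lt_xy; apply/eqP; rewrite eqn_leq; apply/andP; split.
  by apply/bigmax_leqP => z /set2P[]->; rewrite // ltnW.
exact: (@leq_bigmax_cond _ _ (fun z : 'I_n.*2 => z : nat) y (set22 x y)).
Qed.

Section FromMatching.

Variable M : {set arc}.
Hypothesis matchM : is_matching M.

Lemma arc_ends A : A \in M ->
  exists x y : 'I_n.*2, [/\ A = [set x; y], x < y, op A = x & cl A = y].
Proof.
move=> MA; have [_ /forall_inP/(_ A MA)/cards2P[x [y [xy ->]]]] := andP matchM.
wlog lt_xy : x y xy / x < y.
  move=> wl; case: (ltngtP x y) => [lt_xy|lt_yx|/val_inj e]; first exact: wl.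
    by rewrite setUC; apply: wl; rewrite // eq_sym.
  by rewrite e eqxx in xy.
by exists x, y; rewrite op_set2 ?cl_set2.
Qed.

Lemma arc_eq A B (x : 'I_n.*2) : A \in M -> B \in M -> x \in A -> x \in B -> A = B.
Proof.
have [/and3P[_ triv _] _] := andP matchM => MA MB Ax Bx.
by rewrite -(def_pblock triv MA Ax) (def_pblock triv MB Bx).
Qed.

Lemma card_matching : #|M| = n.
Proof.
have [partM /forall_inP card2] := andP matchM.
have := card_uniform_partition (fun A MA => eqP (card2 A MA)) partM.
rewrite cardsT card_ord => e; apply/esym/eqP.
by rewrite -(eqn_pmul2r (isT : 0 < 2)) -e muln2.
Qed.

Definition arcs := sort (fun A B => cl A <= cl B) (enum M).

Lemma size_arcs : size arcs = n.
Proof. by rewrite size_sort -cardE card_matching. Qed.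

Lemma mem_arcs A : (A \in arcs) = (A \in M).
Proof. by rewrite mem_sort mem_enum. Qed.

Lemma arc_nth_mem i : arc_nth M i \in M.
Proof. by rewrite -mem_arcs mem_nth // size_arcs. Qed.

Lemma arc_nthP A : A \in M -> exists i, A = arc_nth M i.
Proof.
rewrite -mem_arcs => /(nthP set0)[i]; rewrite size_arcs => lt_i <-.
by exists (Ordinal lt_i).
Qed.

Lemma cl_inj : {in M &, injective (@cl n)}.
Proof.
move=> A B MA MB; have [x [y [defA _ _ ->]]] := arc_ends MA.
have [x' [y' [defB _ _ ->]]] := arc_ends MB => /val_inj yy'.
by apply: (arc_eq (x := y)) => //; rewrite ?defA ?defB ?yy' set22.
Qed.

Lemma sorted_arcs : sorted (fun A B => cl A < cl B) arcs.
Proof.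
suff : sorted ltn (map (@cl n) arcs) by rewrite sorted_map.
rewrite ltn_sorted_uniq_leq; apply/andP; split.
  rewrite map_inj_in_uniq ?sort_uniq ?enum_uniq // => A B; rewrite !mem_arcs.
  exact: cl_inj.
by rewrite sorted_map; apply: sort_sorted => A B; apply: leq_total.
Qed.

Lemma ltn_cl i j : i < j -> cl (arc_nth M i) < cl (arc_nth M j).
Proof.
have tr : transitive (fun A B => cl A < cl B) by move=> B A C; apply: ltn_trans.
by apply: (sorted_ltn_nth tr set0 sorted_arcs); rewrite inE size_arcs.
Qed.

Lemma leq_cl i j : i <= j -> cl (arc_nth M i) <= cl (arc_nth M j).
Proof. by rewrite leq_eqVlt => /predU1P[/val_inj->|/ltn_cl/ltnW]. Qed.

(** The labels [inl i] for openers and [inr i] for closers are common to all matchings, which allows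
    matchings to be compared. *)
Definition point (t : 'I_n + 'I_n) : nat :=
  match t with inl i => op (arc_nth M i) | inr i => cl (arc_nth M i) end.

Definition arc_index (t : 'I_n + 'I_n) : 'I_n := match t with inl i | inr i => i end.

Lemma pointP t : exists2 x : 'I_n.*2, point t = x & x \in arc_nth M (arc_index t).
Proof.
by case: t => i /=; have [x [y [defA _ ex ey]]] := arc_ends (arc_nth_mem i);
  [exists x | exists y]; rewrite ?ex ?ey // defA ?set21 ?set22.
Qed.

Lemma point_lt t : point t < n.*2.
Proof. by have [x ->] := pointP t. Qed.

Lemma ltn_op_cl i : op (arc_nth M i) < cl (arc_nth M i).
Proof. by have [x [y [_ lt_xy -> ->]]] := arc_ends (arc_nth_mem i). Qed.

Lemma arc_nth_inj : injective (fun i => arc_nth M i).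
Proof.
move=> i j e; apply: val_inj; case: (ltngtP i j) => // /ltn_cl; by rewrite e ltnn.
Qed.

Lemma point_inj : injective point.
Proof.
move=> t u e; have [x ex tx] := pointP t; have [y ey uy] := pointP u.
have xy : x = y by apply: val_inj; rewrite /= -ex -ey.
have := arc_eq (arc_nth_mem _) (arc_nth_mem _) tx; rewrite xy => /(_ _ uy).
move/arc_nth_inj; move: e; case: t {ex tx} => i; case: u {ey uy} => j //= e ij;
  rewrite -?ij // in e *.
- by have := ltn_op_cl i; rewrite e ltnn.
- by have := ltn_op_cl i; rewrite e ltnn.
Qed.

Lemma point_surj m : m < n.*2 -> exists t, point t = m.
Proof.
move=> lt_m; have [/and3P[/eqP cov _ _] _] := andP matchM.
have : Ordinal lt_m \in cover M by rewrite cov inE.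
case/bigcupP=> A /arc_nthP[i ->]; have [x [y [defA _ ex ey]]] := arc_ends (arc_nth_mem i).
by rewrite defA => /set2P[] e; [exists (inl i) | exists (inr i)]; rewrite /= ?ex ?ey -e.
Qed.

End FromMatching.

(** Closers increase with the arc index, so the index of the first closer after an opener is the
    number of closers before it. *)
Definition matching_code M : seq nat :=
  mkseq (fun m => find (fun l => op (arc_nth M m) < cl (arc_nth M l)) (iota 0 n)) n.

Lemma size_matching_code M : size (matching_code M) = n.
Proof. exact: size_mkseq. Qed.

Definition code_spec M (c : seq nat) :=
  forall i j, (op (arc_nth M i) < cl (arc_nth M j)) = (nth 0 c i <= j).

Lemma matching_codeP M : is_matching M -> code_spec M (matching_code M).
Proof.
move=> matchM i j; rewrite nth_mkseq //; set a := fun _ => _.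
have find_lt : find a (iota 0 n) < n.
  rewrite -{2}(size_iota 0 n) -has_find; apply/hasP; exists (i : nat).
    by rewrite mem_iota add0n ltn_ord.
  exact: ltn_op_cl.
case: (leqP (find a (iota 0 n)) j) => [le_j|lt_j].
  have : has a (iota 0 n) by rewrite has_find size_iota.
  move/(nth_find 0); rewrite nth_iota // add0n {1}/a => lt_op.
  by apply: leq_trans lt_op _; apply: (@leq_cl _ matchM (Ordinal find_lt)).
have := before_find 0 lt_j; rewrite nth_iota // add0n; exact.
Qed.

Lemma matching_code_codes M : is_matching M -> matching_code M \in codes n.
Proof.
move=> matchM; apply/codesP; rewrite size_mkseq; split=> // i; rewrite size_mkseq => lt_i.
by rewrite -(matching_codeP matchM (Ordinal lt_i) (Ordinal lt_i)); apply: ltn_op_cl.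
Qed.

Lemma code_specE M c c' : c \in codes n -> c' \in codes n ->
  code_spec M c -> code_spec M c' -> c = c'.
Proof.
move=> /codesP[size_c sub_c] /codesP[size_c' sub_c'] spec_c spec_c'.
apply: (@eq_from_nth _ 0) => [|m]; rewrite size_c // => lt_m.
have le_c : nth 0 c m < n by rewrite (leq_ltn_trans (sub_c _ _)) ?size_c.
have le_c' : nth 0 c' m < n by rewrite (leq_ltn_trans (sub_c' _ _)) ?size_c'.
apply/eqP; rewrite eqn_leq.
have /= := spec_c (Ordinal lt_m) (Ordinal le_c').
rewrite (spec_c' (Ordinal lt_m) (Ordinal le_c')) /= leqnn => <-.
have /= := spec_c' (Ordinal lt_m) (Ordinal le_c).
by rewrite (spec_c (Ordinal lt_m) (Ordinal le_c)) /= leqnn => <-.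
Qed.

End MatchingCode.

(** * The order of the points as a function of the code *)

Section OrderOfPoints.

Variable n : nat.
Implicit Types (i j k : 'I_n) (t u : 'I_n + 'I_n) (c : seq nat).

(* Lists the openers before the closer [j] among those in the gap before it, by
   increasing arc number. *)
Definition point_key c t : nat :=
  match t with inl i => nth 0 c i * n.+1 + i | inr j => j * n.+1 + n end.

(** Pairs are read as two digits in base [n.+1]. The last digit [n] of a closer exceeds the digits
    [i < n] of the openers in its gap. *)
Lemma ltn_lex a b a' b' : b <= n -> b' <= n ->
  (a * n.+1 + b < a' * n.+1 + b') = (a < a') || ((a == a') && (b < b')).
Proof.
move=> le_b le_b'; case: (ltngtP a a') => [lt_a|lt_a|->] /=; last by rewrite ltn_add2l.
  by have := leq_mul2r n.+1 a.+1 a'; rewrite lt_a orbT mulSn; lia.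
by have := leq_mul2r n.+1 a'.+1 a; rewrite lt_a orbT mulSn; lia.
Qed.

Lemma ltn_key_op c i j : (point_key c (inl i) < point_key c (inl j)) =
  (nth 0 c i < nth 0 c j) || ((nth 0 c i == nth 0 c j) && (i < j)).
Proof. by rewrite ltn_lex // ltnW. Qed.

Lemma ltn_key_op_cl c i j : (point_key c (inl i) < point_key c (inr j)) = (nth 0 c i <= j).
Proof. by rewrite ltn_lex ?(ltnW (ltn_ord i)) // ltn_ord andbT orbC -leq_eqVlt. Qed.

Lemma ltn_key_cl c i j : (point_key c (inr i) < point_key c (inr j)) = (i < j).
Proof. by rewrite ltn_lex // ltnn andbF orbF. Qed.

Lemma point_key_inj c : injective (point_key c).
Proof.
have lex_inj a b a' b' : b <= n -> b' <= n ->
    a * n.+1 + b = a' * n.+1 + b' -> a = a' /\ b = b'.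
  move=> le_b le_b' e; have := ltnn (a * n.+1 + b); rewrite {2}e ltn_lex //.
  have := ltnn (a' * n.+1 + b'); rewrite -{2}e ltn_lex //; lia.
move=> [i|i] [j|j] /= e; have [] := lex_inj _ _ _ _ _ _ e; rewrite ?(ltnW (ltn_ord _)) //.
- by move=> _ /val_inj->.
- by move=> _ ei; have := ltn_ord i; rewrite ei ltnn.
- by move=> _ ej; have := ltn_ord j; rewrite -ej ltnn.
- by move=> /val_inj->.
Qed.

Section NoLeftNesting.

Variable M : {set {set 'I_n.*2}}.
Hypothesis nlnM : M \in no_left_nesting n.

Let matchM : is_matching M.
Proof. by move: nlnM; rewrite inE => /andP[]. Qed.

Variable c : seq nat.
Hypothesis c_code : c \in codes n.
Hypothesis spec_c : code_spec M c.

(** Arcs are numbered by closer, so two adjacent openers with the larger index first would form a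
    left nesting. *)
Lemma adjacent_openers i j :
  op (arc_nth M i) = (op (arc_nth M j)).+1 -> j <= i.
Proof.
move=> e; rewrite leqNgt; apply/negP => lt_ij.
move: nlnM; rewrite inE => /andP[_ /negP[]].
apply/existsP; exists (arc_nth M i); rewrite arc_nth_mem //=.
apply/existsP; exists (arc_nth M j); rewrite arc_nth_mem //=.
by rewrite /left_nesting e ltnSn -e eqxx ltn_op_cl //= ltn_cl.
Qed.

Let c_lt i : nth 0 c i < n.
Proof.
have /codesP[size_c sub_c] := c_code.
by rewrite (leq_ltn_trans (sub_c _ _)) ?size_c.
Qed.

Lemma code_le i j : op (arc_nth M i) <= op (arc_nth M j) -> nth 0 c i <= nth 0 c j.
Proof.
move=> le_ij; have := spec_c i (Ordinal (c_lt j)); rewrite /= => <-.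
by apply: leq_ltn_trans le_ij _; rewrite (spec_c j (Ordinal (c_lt j))) /=.
Qed.

(** Induction on the distance: equal codes leave no closer in between, so the next point is an
    opener with the same code, and [adjacent_openers] applies to it. *)
Lemma openers_in_gap i j : op (arc_nth M j) <= op (arc_nth M i) ->
  nth 0 c i = nth 0 c j -> j <= i.
Proof.
move=> /subnKC; move: (op _ - op _) => d; elim: d j => [|d IHd] j e cij.
  rewrite addn0 in e; have /= := @point_inj _ _ matchM (inl j) (inl i) e.
  by case=> ->.
have lt_j : (op (arc_nth M j)).+1 <= op (arc_nth M i) by rewrite -e addnS ltnS leq_addr.
have lt_i : op (arc_nth M i) < n.*2 by apply: (point_lt matchM (inl i)).
have [[k|k] /= ek] := point_surj matchM (leq_ltn_trans lt_j lt_i).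
  have ck : nth 0 c k = nth 0 c j.
    apply/eqP; rewrite eqn_leq -{1}cij !code_le ?ek //.
  apply: leq_trans (adjacent_openers ek) (IHd _ _ _); last by rewrite cij ck.
  by rewrite ek -e addnS addSn.
have : nth 0 c j <= k by rewrite -spec_c ek.
rewrite -cij -spec_c ek; lia.
Qed.

(** One implication is enough, since distinct labels have distinct keys and keys are totally
    ordered. *)
Lemma ltn_point t u : (point M t < point M u) = (point_key c t < point_key c u).
Proof.
have lt_point a b : point_key c a < point_key c b -> point M a < point M b.
  case: a b => i [] j.
  - rewrite ltn_key_op /=; case: (ltngtP (nth 0 c i)) => //= [lt_c _|e lt_ij].
      by rewrite ltnNge; apply: contraL lt_c => /code_le; rewrite -leqNgt.
    by rewrite ltnNge; apply: contraL lt_ij => le_op; rewrite -leqNgt openers_in_gap.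
  - by rewrite ltn_key_op_cl /= spec_c.
  - move=> lt_k; rewrite /= ltnNge leq_eqVlt negb_or spec_c; apply/andP; split.
      by apply/eqP => /(@point_inj _ _ matchM (inl j) (inr i)).
    by rewrite -ltn_key_op_cl -leqNgt ltnW.
  - by rewrite ltn_key_cl; apply: ltn_cl.
case: (ltngtP (point_key c t) (point_key c u)) => [/lt_point->//|/lt_point lt_ut|].
  by rewrite ltnNge ltnW.
by move/point_key_inj->; rewrite ltnn.
Qed.

Lemma point_rank t : point M t = rank (point_key c) t.
Proof.
rewrite -(rank_id (point_inj matchM)) => [|u]; last first.
  by rewrite card_sum card_ord addnn; apply: point_lt.
by apply: eq_card => u; rewrite !inE ltn_point.
Qed.

End NoLeftNesting.

Lemma matching_code_inj : {in no_left_nesting n &, injective (@matching_code n)}.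
Proof.
suff sub M M' : M \in no_left_nesting n -> M' \in no_left_nesting n ->
    matching_code M = matching_code M' -> M \subset M'.
  by move=> M M' nM nM' e; apply/eqP; rewrite eqEsubset !sub.
move=> nM nM' e.
have mM : is_matching M by move: nM; rewrite inE => /andP[].
have mM' : is_matching M' by move: nM'; rewrite inE => /andP[].
apply/subsetP => A /(arc_nthP mM)[i ->].
have same t : point M t = point M' t.
  rewrite (point_rank nM (matching_code_codes mM) (matching_codeP mM)) e.
  by rewrite (point_rank nM' (matching_code_codes mM') (matching_codeP mM')).
have [x [y [defM _ ex ey]]] := arc_ends mM (arc_nth_mem mM i).
have [x' [y' [defA _ ex' ey']]] := arc_ends mM' (arc_nth_mem mM' i).
have xx' : x = x' by apply: val_inj; rewrite /= -ex -ex'; apply: (same (inl i)).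
have yy' : y = y' by apply: val_inj; rewrite /= -ey -ey'; apply: (same (inr i)).
by rewrite defM xx' yy' -defA arc_nth_mem.
Qed.

End OrderOfPoints.

(** * The matching of a code *)

Section MatchingOfCode.

Variables (n : nat) (c : seq nat).
Hypothesis c_code : c \in codes n.
Implicit Types (i j k : 'I_n) (t u : 'I_n + 'I_n).

Lemma rank_lt_double t : rank (point_key c) t < n.*2.
Proof. by apply: leq_trans (rank_lt _ _) _; rewrite card_sum card_ord addnn. Qed.

Definition code_point t : 'I_n.*2 := Ordinal (rank_lt_double t).

Definition code_arc i : {set 'I_n.*2} := [set code_point (inl i); code_point (inr i)].

Definition code_matching : {set {set 'I_n.*2}} := [set code_arc i | i : 'I_n].

Lemma ltn_code_point t u : (code_point t < code_point u) = (point_key c t < point_key c u).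
Proof. exact: ltn_rank. Qed.

Lemma code_point_inj : injective code_point.
Proof. by move=> t u /(congr1 val)/(rank_inj (@point_key_inj n c)). Qed.

Lemma code_point_surj x : exists t, x = code_point t.
Proof.
have le_card : #|'I_n.*2| <= #|{: 'I_n + 'I_n}| by rewrite card_sum !card_ord addnn.
by have [g _ gK] := inj_card_bij code_point_inj le_card; exists (g x); rewrite gK.
Qed.

Lemma code_le_index i : nth 0 c i <= i.
Proof. by have /codesP[size_c sub_c] := c_code; apply: sub_c; rewrite size_c. Qed.

Lemma op_code_arc i : op (code_arc i) = code_point (inl i).
Proof. by rewrite op_set2 // ltn_code_point ltn_key_op_cl code_le_index. Qed.

Lemma cl_code_arc i : cl (code_arc i) = code_point (inr i).
Proof. by rewrite cl_set2 // ltn_code_point ltn_key_op_cl code_le_index. Qed.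

Lemma mem_code_arc t i : (code_point t \in code_arc i) = (arc_index t == i).
Proof.
by rewrite !inE !(inj_eq code_point_inj); case: t => j; rewrite /= /eq_op /= ?orbF.
Qed.

Lemma is_matching_code : is_matching code_matching.
Proof.
apply/andP; split; last first.
  by apply/forall_inP => _ /imsetP[i _ ->]; rewrite cards2 (inj_eq code_point_inj).
apply/and3P; split.
- apply/eqP/setP => x; rewrite inE; have [t ->] := code_point_surj x.
  apply/bigcupP; exists (code_arc (arc_index t)); first exact: imset_f.
  by rewrite mem_code_arc.
- apply/trivIsetP => _ _ /imsetP[i _ ->] /imsetP[j _ ->] neq_ij.
  apply/pred0P => x /=; have [t ->] := code_point_surj x; rewrite !mem_code_arc.
  by apply: contraNF neq_ij => /andP[/eqP<- /eqP<-].
- by apply/imsetP => -[i _ /setP/(_ (code_point (inl i)))]; rewrite mem_code_arc inE eqxx.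
Qed.

Lemma arc_nth_code i : arc_nth code_matching i = code_arc i.
Proof.
have -> : arc_nth code_matching i = nth set0 [seq code_arc j | j <- enum 'I_n] i.
  congr nth; apply: (@irr_sorted_eq _ (fun A B => cl A < cl B)).
  - by move=> B A C; apply: ltn_trans.
  - by move=> A; apply: ltnn.
  - exact: sorted_arcs is_matching_code.
  - rewrite sorted_map.
    have : sorted ltn (map val (enum 'I_n)) by rewrite val_enum_ord iota_ltn_sorted.
    rewrite sorted_map; apply: sub_sorted => j k /= lt_jk.
    by rewrite !cl_code_arc ltn_code_point ltn_key_cl.
  - move=> A; rewrite mem_arcs; apply/imsetP/mapP => [[j _ ->]|[j _ ->]]; exists j => //.
    by rewrite mem_enum.
by rewrite (nth_map i) ?size_enum_ord // nth_ord_enum.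
Qed.

(** Suppose the opener of [j] is immediately followed by that of [i], with [i < j]. Then the entry
    of [c] at [j] is smaller than the one at [i], and the closer it numbers would lie strictly
    between the two openers. *)
Lemma no_left_nesting_code : code_matching \in no_left_nesting n.
Proof.
rewrite inE is_matching_code; apply/negP => /existsP[A /andP[/imsetP[i _ ->]]].
case/existsP=> B /andP[/imsetP[j _ ->]] /and4P[lt_op _ lt_cl /eqP op_i].
have lt_cj : nth 0 c j < n by apply: leq_ltn_trans (code_le_index j) _.
move: lt_op lt_cl op_i; rewrite !op_code_arc !cl_code_arc !ltn_code_point ltn_key_cl.
rewrite ltn_key_op => /orP[lt_c|/andP[_ lt_ji]] lt_ij op_i; last by lia.
have : code_point (inl j) < code_point (inr (Ordinal lt_cj)).
  by rewrite ltn_code_point ltn_key_op_cl /=.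
have : code_point (inr (Ordinal lt_cj)) < code_point (inl i).
  rewrite ltn_code_point ltnNge leq_eqVlt negb_or ltn_key_op_cl -ltnNge lt_c andbT.
  by apply/eqP => /point_key_inj.
by rewrite op_i ltnS leqNgt => /negP.
Qed.

Lemma code_spec_code : code_spec code_matching c.
Proof.
move=> i j; rewrite !arc_nth_code op_code_arc cl_code_arc ltn_code_point.
exact: ltn_key_op_cl.
Qed.

Lemma matching_code_code : matching_code code_matching = c.
Proof.
apply: (@code_specE n code_matching) => //.
- exact: matching_code_codes is_matching_code.
- exact: matching_codeP is_matching_code.
- exact: code_spec_code.
Qed.

End MatchingOfCode.

Lemma matching_codes n :
  perm_eq [seq matching_code M | M <- enum (no_left_nesting n)] (codes n).
Proof.
apply: uniq_perm; last first.
- move=> c; apply/mapP/idP => [[M + ->]|c_code].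
    by rewrite mem_enum inE => /andP[matchM _]; apply: matching_code_codes.
  exists (code_matching n c); last by rewrite matching_code_code.
  by rewrite mem_enum no_left_nesting_code.
- exact: codes_uniq.
rewrite map_inj_in_uniq ?enum_uniq // => M M'; rewrite !mem_enum.
exact: matching_code_inj.
Qed.

(** * Matching statistics read off the code *)

Section MatchingStatistics.

Variables (n : nat) (M : {set {set 'I_n.*2}}).
Hypothesis nlnM : M \in no_left_nesting n.
Let c := matching_code M.
Implicit Types (i j k : 'I_n).

Let matchM : is_matching M.
Proof. by move: nlnM; rewrite inE => /andP[]. Qed.

Let c_code : c \in codes n := matching_code_codes matchM.
Let spec_c : code_spec M c := matching_codeP matchM.

Lemma mmin_matching_code : mmin M = count_mem 0 c.
Proof.
rewrite (@count_code n c) ?size_matching_code //.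
apply: eq_card => i; rewrite !inE /= -leqn0.
have n_gt0 : 0 < n by apply: leq_ltn_trans (ltn_ord i).
exact: (spec_c i (Ordinal n_gt0)).
Qed.

(** The points between the closers [i.-1] and [i] are exactly the openers with code [i]. *)
Lemma adjacent_closers i : 0 < i ->
  ((cl (arc_nth M i.-1)).+1 == cl (arc_nth M i)) = ((i : nat) \notin c).
Proof.
move=> i_gt0; have /codesP[size_c sub_c] := c_code.
have lt_i1 : i.-1 < n by rewrite (leq_ltn_trans (leq_pred i)).
pose i1 := Ordinal lt_i1; have lt_i : i1 < i by rewrite /= ltn_predL.
have lt_cl : cl (arc_nth M i1) < cl (arc_nth M i) by apply: ltn_cl.
apply/eqP/idP => [adj|nci].
  apply/negP => /(nthP 0)[m]; rewrite size_c => lt_m cm.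
  have /= op_i := spec_c (Ordinal lt_m) i; have /= op_i1 := spec_c (Ordinal lt_m) i1.
  rewrite cm leqnn -adj ltnS in op_i.
  rewrite cm [i <= _]leqNgt ltn_predL i_gt0 /= ltn_neqAle op_i andbT in op_i1.
  by move/negbFE/eqP: op_i1 => /(@point_inj _ _ matchM (inl (Ordinal lt_m)) (inr i1)).
apply/eqP; rewrite eqn_leq lt_cl leqNgt; apply/negP => lt2.
have lt_cli : cl (arc_nth M i) < n.*2 by apply: (point_lt matchM (inr i)).
(* Consider the point right after closer [i.-1]: an opener there would have code [i], and a closer
   would have an index strictly between [i.-1] and [i]. *)
have [[j|k] /= e] := point_surj matchM (ltn_trans lt2 lt_cli).
  have := spec_c j i; have := spec_c j i1; rewrite e lt2 ltnNge leqnSn /= => le1 le2.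
  have cj : nth 0 c j = i by lia.
  by move/negP: nci; apply; rewrite -cj mem_nth // size_c.
case: (ltngtP i1 k) => [lt_k|lt_k|e1].
- case: (ltngtP k i) => [lt_ki|/(ltn_cl matchM)|/val_inj ei]; first by move: lt_k => /=; lia.
    by rewrite e ltnNge (ltnW lt2).
  by rewrite -e ei ltnn in lt2.
- by have := ltn_cl matchM lt_k; rewrite e ltnNge leqnSn.
by move/val_inj: e1 e => <- /n_Sn.
Qed.

Lemma rne_matching_code : rne M = #|descents n (fun _ => id) c|.
Proof.
apply: eq_card => i; rewrite !inE; case: (posnP i) => //= i_gt0.
have lt_i1 : i.-1 < n by rewrite (leq_ltn_trans (leq_pred i)).
rewrite adjacent_closers // (ltn_op_cl matchM (Ordinal lt_i1)) /= andbC; congr (_ && _).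
have := ltn_point nlnM c_code spec_c (inl i) (inl (Ordinal lt_i1)).
(* With equal codes the opener of the smaller index comes first, so only the strict inequality of
   codes remains. *)
by rewrite ltn_key_op /= [i < _]ltnNge leq_pred andbF orbF => ->.
Qed.

Lemma mint_matching_code : 0 < n ->
  mint M - 1 = #|[set i : 'I_n | 0 < i & (i : nat) \in c]|.
Proof.
move=> n_gt0; rewrite /mint.
have -> : [set i : 'I_n | (0 < i) && ((cl (arc_nth M i.-1)).+1 == cl (arc_nth M i))] =
    [set i : 'I_n | 0 < i] :\: [set i : 'I_n | 0 < i & (i : nat) \in c].
  apply/setP => i; rewrite !inE; case: (posnP i) => //= i_gt0.
  by rewrite adjacent_closers // andbT.
rewrite cardsD (setIidPr _); last by apply/subsetP => i; rewrite !inE => /andP[].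
have le_card : #|[set i : 'I_n | 0 < i & (i : nat) \in c]| <= #|[set i : 'I_n | 0 < i]|.
  by apply: subset_leq_card; apply/subsetP => i; rewrite !inE => /andP[].
(* There are [n - 1] nonzero indices, so none of the truncated subtractions loses anything. *)
move: le_card; have -> : [set i : 'I_n | 0 < i] = [set~ Ordinal n_gt0].
  by apply/setP => i; rewrite !inE lt0n.
by rewrite cardsC1 card_ord; lia.
Qed.

End MatchingStatistics.

(** * Comparison of the two generating functions *)

Local Open Scope ring_scope.

Theorem theorem8p3 (n : nat) (hn : (0 < n)%N)
    (R : comNzRingType) (s x w : R) :
  \sum_(p : {perm 'I_n}) s ^+ rmin p * x ^+ psilly p * w ^+ des p =
  \sum_(M in no_left_nesting n) s ^+ mmin M * x ^+ rne M * w ^+ (mint M - 1)%N.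
Proof.
(* [phi] collects the two statistics that depend only on the multiset of entries. *)
pose phi c := s ^+ count_mem 0%N c * w ^+ #|[set i : 'I_n | (0 < i)%N & (i : nat) \in c]|.
have sym_phi : symmetric_seq phi.
  move=> c c' cc'; rewrite /phi (seq.permP cc'); congr (_ * _ ^+ _).
  by apply: eq_card => i; rewrite !inE (perm_mem cc').
transitivity (\sum_(c <- codes n) phi c * x ^+ #|descents n pos c|).
  rewrite -(perm_big _ (perm_codes n)) big_map big_enum /=; apply: eq_bigr => p _.
  by rewrite rmin_perm_code psilly_perm_code des_perm_code mulrAC.
rewrite (sum_codes_descents n x good_key_pos good_key_id sym_phi).
rewrite -(perm_big _ (matching_codes n)) big_map big_enum /=; apply: eq_bigr => M nlnM.
by rewrite mmin_matching_code // rne_matching_code // mint_matching_code // mulrAC.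
Qed.
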